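(* Let $\lambda$ be a nonzero real number and $r\geq 0$ an integer. Let $a,a^\dagger$ be the boson annihilation and creation operators and $\hat{n}=a^\dagger a$ the number operator. Then for every integer $n\geq 0$, $$(\hat{n}+r)_{n,\lambda}=(a^\dagger a+r)_{n,\lambda}=\sum_{k=0}^n \begin{Bmatrix}n+r \\ k+r \end{Bmatrix}_{r,\lambda}(a^\dagger)^k a^k,$$ and for every integer $n\geq r$, $$(\hat{n})_{n-r,\lambda}(a^\dagger)^r a^r=(a^\dagger a)_{n-r,\lambda}(a^\dagger)^r a^r=\sum_{k=r}^n \begin{Bmatrix}n \\ k \end{Bmatrix}_{r,\lambda} (a^\dagger)^{k} a^k.$$
   Context: Degenerate falling factorials: $(x)_{0,\lambda}=1$ and $(x)_{k,\lambda}=x(x-\lambda)\cdots(x-(k-1)\lambda)$ for $k\geq1$; for an operator $X$, $(X)_{k,\lambda}=X(X-\lambda)\cdots(X-(k-1)\lambda)$ (with $X+c$ meaning $X+c\cdot\mathrm{Id}$). Ordinary falling factorials: $(x)_0=1$, $(x)_k=x(x-1)\cdots(x-k+1)$. For an integer $r\geq0$, the degenerate $r$-Stirling numbers of the second kind $\begin{Bmatrix}n+r \\ k+r \end{Bmatrix}_{r,\lambda}$ ($0\le k\le n$) are defined by the polynomial identity $(x+r)_{n,\lambda}=\sum_{k=0}^n \begin{Bmatrix}n+r \\ k+r \end{Bmatrix}_{r,\lambda}(x)_k$ for all $n\geq0$; for integers $n\ge k\ge r$, the symbol $\begin{Bmatrix}n \\ k \end{Bmatrix}_{r,\lambda}$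 denotes $\begin{Bmatrix}(n-r)+r \\ (k-r)+r \end{Bmatrix}_{r,\lambda}$. Boson operators: on the space spanned by orthonormal number states $|m\rangle$, $m=0,1,2,\dots$, one has $a|m\rangle=\sqrt{m}\,|m-1\rangle$ (with $a|0\rangle=0$) and $a^\dagger|m\rangle=\sqrt{m+1}\,|m+1\rangle$, so that $aa^\dagger-a^\dagger a=1$ and $\hat n|m\rangle=m|m\rangle$. The identities are equalities of operators on this space. *)

(* Defs.v *)
(* MathComp with the classical and reals layers of MathComp-Analysis, and
   mathcomp-real-closed for the complex field R[i] over a realType R. *)
From HB Require Import structures.
From mathcomp Require Import all_boot all_order all_algebra.
From mathcomp Require Import sesquilinear.
From mathcomp Require Import boolp functions reals.
From mathcomp Require Import complex.

Set Implicit Arguments.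
Unset Strict Implicit.
Unset Printing Implicit Defensive.

Import Order.TTheory GRing.Theory Num.Theory.
Local Open Scope ring_scope.
Local Open Scope complex_scope.

Section FallingFactorials.
Variable A : comNzRingType.

(* (x)_{k,lam} *)
Definition dffact (lam x : A) (k : nat) : A := \prod_(i < k) (x - lam *+ i).

(* (x)_k *)
Definition ffactr (x : A) (k : nat) : A := \prod_(i < k) (x - i%:R).

End FallingFactorials.

Section DegenerateStirling.
Variables (R : realType) (lam : R) (r : nat).

(* S N K plays the role of {N K}_{r,lam}; it is constrained only in the range
   N >= K >= r where that symbol is meaningful. *)
Definition is_rstirling2 (S : nat -> nat -> R) : Prop :=
  forall n : nat,
    dffact lam%:P ('X + r%:R) n
    = \sum_(k < n.+1) S (n + r)%N (k + r)%N *: ffactr 'X k.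

Lemma is_rstirling2_exists : exists S, is_rstirling2 S.
Proof.
pose fix T (n k : nat) {struct n} : R :=
  match n with
  | 0 => (k == 0)%N%:R
  | n'.+1 => (if k is k'.+1 then T n' k' else 0)
             + (k%:R + r%:R - lam *+ n') * T n' k
  end.
have T0 n k : (n < k)%N -> T n k = 0.
  elim: n k => [|n IHn] [|k] //= ltnk.
  by rewrite !IHn ?mulr0 ?addr0 // ltnW.
exists (fun N K => T (N - r)%N (K - r)%N) => n.
under eq_bigr => k _ do rewrite !addnK.
elim: n => [|n IHn].
  by rewrite big_ord_recr big_ord0 /dffact /ffactr !big_ord0 /= scale1r add0r.
have E k : ffactr 'X k * ('X + r%:R - lam%:P *+ n) =
    ffactr 'X k.+1 + (k%:R + r%:R - lam *+ n) *: ffactr 'X k :> {poly R}.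
  rewrite [ffactr _ k.+1]big_ord_recr /= -/(ffactr _ _).
  rewrite -mul_polyC polyCB polyCD !polyC_natr polyCMn.
  rewrite [X in _ = _ + X]mulrC -mulrDr; congr (_ * _).
  by rewrite !addrA subrK.
rewrite /dffact big_ord_recr /= -/(dffact _ _ _) IHn big_distrl /=.
under eq_bigr => k _ do rewrite -scalerAl E scalerDr scalerA.
under [RHS]eq_bigr => k _ do rewrite scalerDl.
rewrite !big_split /=; congr (_ + _).
  by rewrite [RHS]big_ord_recl scale0r add0r.
rewrite [RHS]big_ord_recr /= (T0 n n.+1) // mulr0 scale0r addr0.
by apply: eq_bigr => k _; rewrite mulrC.
Qed.

Lemma is_rstirling2_unique S S' : is_rstirling2 S -> is_rstirling2 S' ->
  forall N K, (r <= K <= N)%N -> S N K = S' N K.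
Proof.
have size_ff k : size (ffactr 'X k : {poly R}) = k.+1.
  rewrite /ffactr; under eq_bigr => i _ do rewrite -polyC_natr.
  by rewrite size_prod_XsubC /index_enum unlock -enumT size_enum_ord.
have ff_free n (c : nat -> R) :
    \sum_(k < n) c k *: ffactr 'X k = 0 -> forall k, (k < n)%N -> c k = 0.
  elim: n => // n IHn; rewrite big_ord_recr /= => s0.
  have cn : c n = 0.
    apply/eqP; apply: contraT => cn0.
    suff: size (\sum_(i < n) c i *: (ffactr 'X i : {poly R})
                + c n *: ffactr 'X n) = n.+1 by rewrite s0 size_poly0.
    rewrite addrC size_polyDl size_scale ?size_ff // ltnS.
    apply/(leq_trans (size_sum _ _ _))/bigmax_leqP => i _.
    by rewrite (leq_trans (size_scale_leq _ _)) // size_ff.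
  move=> k; rewrite ltnS leq_eqVlt => /predU1P[-> //|].
  by apply: IHn; move: s0; rewrite cn scale0r addr0.
move=> HS HS' N K /andP[rK KN].
have := ff_free (N - r).+1 (fun k => S N (k + r)%N - S' N (k + r)%N).
have rN := leq_trans rK KN.
move=> /(_ _ (K - r)%N); rewrite subnK // => H; apply/eqP; rewrite -subr_eq0.
apply/eqP; apply: H; last by rewrite ltnS leq_sub2r.
under eq_bigr do rewrite scalerBl.
by rewrite sumrB; move: (HS (N - r)%N) (HS' (N - r)%N);
  rewrite !subnK // => <- <-; rewrite subrr.
Qed.

(* {N K}_{r,lam}; unspecified unless N >= K >= r. *)
Definition rstirling2 : nat -> nat -> R := sval (cid is_rstirling2_exists).

Lemma rstirling2P : is_rstirling2 rstirling2.
Proof. exact: svalP (cid is_rstirling2_exists). Qed.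

End DegenerateStirling.

Section Operators.
Variables (R : realType) (V : lmodType R[i]).

(* X + c, i.e. X + c . Id, for the pointwise module structure on V -> V. *)
Definition op_shift (X : V -> V) (c : R) : V -> V := X + c%:C *: (@idfun V).

(* (X)_{k,lam}, the product of operators being composition. *)
Fixpoint op_dffact (lam : R) (X : V -> V) (k : nat) : V -> V :=
  if k is k'.+1 then op_dffact lam X k' \o op_shift X (- (lam *+ k'))
  else idfun.

Definition number_op (a adag : V -> V) : V -> V := adag \o a.

(* V is the (algebraic, uncompleted) complex span of the orthonormal number
   states ket 0, ket 1, ..., and a, adag act on them as the boson annihilation
   and creation operators. *)
Record boson_operators (dot : {dot V for (@Num.conj R[i])}) (ket : nat -> V)
    (a adag : {linear V -> V}) : Prop := BosonOperators {
  ket_orthonormal : forall m n : nat, dot (ket m) (ket n) = (m == n)%:R;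
  ket_span : forall v : V, exists (N : nat) (c : nat -> R[i]),
    v = \sum_(m < N) c m *: ket m;
  annih_ket0 : a (ket 0%N) = 0;
  annih_ketS : forall m : nat,
    a (ket m.+1) = (Num.sqrt m.+1%:R)%:C *: ket m;
  creat_ket : forall m : nat,
    adag (ket m) = (Num.sqrt m.+1%:R)%:C *: ket m.+1
}.

End Operators.

(* The axioms boson_operators are realised on {poly R[i]} with ket m = 'X^m. *)
Section PolynomialModel.
Variable R : realType.
Local Notation C := R[i].

Definition fock_dot (p q : {poly C}) : C :=
  \sum_(m < maxn (size p) (size q)) p`_m * Num.conj q`_m.

Lemma fock_dotE N (p q : {poly C}) : (size p <= N)%N -> (size q <= N)%N ->
  fock_dot p q = \sum_(m < N) p`_m * Num.conj q`_m.
Proof.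
move=> pN qN; rewrite /fock_dot.
rewrite (big_ord_widen N (fun m => p`_m * Num.conj q`_m)) ?geq_max ?pN //.
rewrite big_mkcond; apply: eq_bigr => m _; case: ifPn => //.
by rewrite -leqNgt geq_max => /andP[pm _]; rewrite nth_default ?mul0r.
Qed.

Lemma fock_dot_hermitian p q :
  fock_dot p q = (-1) ^+ false * Num.conj (fock_dot q p).
Proof.
rewrite expr0 mul1r /fock_dot maxnC rmorph_sum; apply: eq_bigr => m _.
by rewrite rmorphM /= conjCK mulrC.
Qed.

Lemma fock_dot_linearl q : linear_for *%R (fock_dot ^~ q).
Proof.
move=> c p p'; pose N := maxn (size q) (maxn (size p) (size p')).
have [qN pN p'N] : [/\ size q <= N, size p <= N & size p' <= N]%N.
  by rewrite !leq_max !leqnn !orbT.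
have cpN : (size ((c *: p + p')%R : {poly C}) <= N)%N.
  apply: (leq_trans (size_polyD _ _)); rewrite geq_max p'N andbT.
  exact: leq_trans (size_scale_leq _ _) pN.
rewrite !(@fock_dotE N) // mulr_sumr -big_split /=; apply: eq_bigr => m _.
by rewrite coefD coefZ mulrDl mulrA.
Qed.

Lemma fock_dot_linearr p : linear_for (Num.conj \; *%R) (fock_dot p).
Proof.
move=> c q q'; rewrite fock_dot_hermitian fock_dot_linearl rmorphD rmorphM.
by rewrite [fock_dot p q]fock_dot_hermitian [fock_dot p q']fock_dot_hermitian
  /= !expr0 !mul1r.
Qed.

HB.instance Definition _ := @bilinear_isBilinear.Build C {poly C} {poly C} C
  *%R (Num.conj \; *%R) fock_dot (fock_dot_linearl, fock_dot_linearr).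
HB.instance Definition _ := @isHermitianSesquilinear.Build C {poly C}
  false Num.conj fock_dot fock_dot_hermitian.

Lemma fock_dot_gt0 p : p != 0 -> 0 < fock_dot p p.
Proof.
move=> p0; have sp : (0 < size p)%N by rewrite lt0n size_poly_eq0.
rewrite (@fock_dotE (size p)) // -(prednK sp) big_ord_recr /=.
apply: ltr_wpDl; last by rewrite mul_conjC_gt0 -lead_coefE lead_coef_eq0.
by apply: sumr_ge0 => m _; rewrite mul_conjC_ge0.
Qed.

HB.instance Definition _ :=
  @isDotProduct.Build C {poly C} fock_dot fock_dot_gt0.

Definition fock_annih (p : {poly C}) : {poly C} :=
  \poly_(m < size p) ((Num.sqrt m.+1%:R)%:C * p`_m.+1).
Definition fock_creat (p : {poly C}) : {poly C} :=
  \poly_(m < (size p).+1) ((Num.sqrt m%:R)%:C * ('X * p)`_m).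

Lemma coef_fock_annih p m :
  (fock_annih p)`_m = (Num.sqrt m.+1%:R)%:C * p`_m.+1.
Proof.
rewrite coef_poly; case: ltnP => // pm.
by rewrite nth_default ?mulr0 // leqW.
Qed.

Lemma coef_fock_creat p m :
  (fock_creat p)`_m = (Num.sqrt m%:R)%:C * ('X * p)`_m.
Proof.
rewrite coef_poly; case: ltnP => // pm.
by rewrite coefXM; case: m pm => // m pm; rewrite nth_default ?mulr0.
Qed.

Lemma fock_annih_linear : linear fock_annih.
Proof.
move=> c p q; apply/polyP => m.
by rewrite !(coefD, coefZ, coef_fock_annih) mulrDr mulrCA.
Qed.

Lemma fock_creat_linear : linear fock_creat.
Proof.
move=> c p q; apply/polyP => m.
rewrite !(coefD, coefZ, coef_fock_creat) mulrDr -scalerAr coefD coefZ.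
by rewrite mulrDr mulrCA.
Qed.

HB.instance Definition _ :=
  GRing.isLinear.Build C {poly C} {poly C} _ fock_annih fock_annih_linear.
HB.instance Definition _ :=
  GRing.isLinear.Build C {poly C} {poly C} _ fock_creat fock_creat_linear.

Lemma boson_operators_fock :
  boson_operators (fock_dot : {dot {poly C} for Num.conj}) (fun m => 'X^m)
    fock_annih fock_creat.
Proof.
split.
- move=> m n /=.
  rewrite (@fock_dotE (maxn m n).+1) ?size_polyXn ?ltnS ?leq_maxl ?leq_maxr //.
  have mN : (m < (maxn m n).+1)%N by rewrite ltnS leq_maxl.
  rewrite (bigD1 (Ordinal mN)) //= big1 => [|i]; rewrite !coefXn.
    by rewrite eqxx mul1r addr0 conjC_nat.
  by rewrite -val_eqE /= => /negPf ->; rewrite mul0r.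
- move=> p; exists (size p), (fun m => p`_m).
  by rewrite -[LHS]coefK poly_def.
- apply/polyP => m; rewrite coef_fock_annih coefXn coef0.
  by rewrite mulr0.
- move=> n; apply/polyP => m; rewrite coef_fock_annih coefZ !coefXn eqSS.
  by case: eqP => [->//|_]; rewrite !mulr0.
- move=> n; apply/polyP => m; rewrite coef_fock_creat coefZ -exprS !coefXn.
  by case: eqP => [->//|_]; rewrite !mulr0.
Qed.

End PolynomialModel.

(* Main.v *)
(* Every operator in the two identities is diagonal in the number basis, so each
   identity reduces to one between eigenvalues: on [ket m] the operator
   [(a^dagger)^k a^k] acts as [(m)_k], and the two sums are the defining
   identity of the degenerate r-Stirling numbers evaluated at [x = m] and at
   [x = m - r], the latter multiplied by [(m)_r], since
   [(m)_r (m - r)_k = (m)_(k + r)]. *)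
Require Import Defs.
From mathcomp Require Import all_boot all_order all_algebra.
From mathcomp Require Import sesquilinear.
From mathcomp Require Import boolp functions reals.
From mathcomp Require Import complex.

Set Implicit Arguments.
Unset Strict Implicit.
Unset Printing Implicit Defensive.

Import Order.TTheory GRing.Theory Num.Theory.
Local Open Scope ring_scope.
Local Open Scope complex_scope.

Section FallingFactorials.
Variable A : comNzRingType.

Lemma ffactrS (x : A) k : ffactr x k.+1 = x * ffactr (x - 1) k.
Proof.
rewrite /ffactr big_ord_recl subr0; congr (_ * _).
by apply: eq_bigr => i _; rewrite /= -addrA -opprD -nat1r.
Qed.

Lemma ffactrD (x : A) r k :
  ffactr x (k + r) = ffactr x r * ffactr (x - r%:R) k.
Proof.
rewrite /ffactr addnC big_split_ord; congr (_ * _).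
by apply: eq_bigr => i _; rewrite /= natrD opprD addrA.
Qed.

Lemma horner_ffactr (x : A) k : (ffactr 'X k).[x] = ffactr x k.
Proof.
rewrite horner_prod; apply: eq_bigr => i _.
by rewrite hornerD hornerX hornerN hornerMn hornerC.
Qed.

Lemma horner_dffact (lam x : A) (p : {poly A}) k :
  (dffact lam%:P p k).[x] = dffact lam p.[x] k.
Proof.
rewrite horner_prod; apply: eq_bigr => i _.
by rewrite hornerD hornerN hornerMn hornerC.
Qed.

End FallingFactorials.

(** The point [x] ranges over all of [R] because the second identity evaluates at [m - r], which is
    negative when [m < r]. *)
Lemma dffact_rstirling2 (R : realType) (lam : R) r n (x : R) :
  dffact lam (x + r%:R) n
  = \sum_(k < n.+1) rstirling2 lam r (n + r) (k + r) * ffactr x k.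
Proof.
have := congr1 (horner_eval x) (rstirling2P lam r n).
rewrite /horner_eval horner_dffact hornerD hornerX hornerMn hornerC => ->.
rewrite horner_sum; apply: eq_bigr => k _.
by rewrite hornerZ horner_ffactr.
Qed.

Section DiagonalOperators.
Variables (R : realType) (V : lmodType R[i]) (ket : nat -> V).

Lemma linear_fun0 (X : V -> V) : linear X -> X 0 = 0.
Proof. by move=> /(_ (-1) 0 0); rewrite scaler0 addr0 scaleN1r addNr. Qed.

(** Linearity is carried as a proposition because sums, shifts and composites are built here as
    plain functions [V -> V]. Eigenvalues are kept in [R] and embedded into [R[i]]. *)
Definition diagonal_op (X : V -> V) (p : nat -> R) : Prop :=
  linear X /\ forall m, X (ket m) = (p m)%:C *: ket m.

(** Linear maps agreeing on a spanning family coincide, by induction on the length of a finite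
    combination of kets. *)
Lemma diagonal_op_ext X Y p q :
  (forall v : V, exists (N : nat) (c : nat -> R[i]),
    v = \sum_(m < N) c m *: ket m) ->
  diagonal_op X p -> diagonal_op Y q -> p =1 q -> X = Y.
Proof.
move=> span [linX Xp] [linY Yq] pq; apply: funext => v.
have [N [c ->]] := span v; elim: N => [|N IHN].
  by rewrite big_ord0 !linear_fun0.
by rewrite big_ord_recr /= addrC linX linY IHN Xp Yq pq.
Qed.

Lemma diagonal_op_eq X p q : p =1 q -> diagonal_op X p -> diagonal_op X q.
Proof. by move=> pq [linX Xp]; split=> // m; rewrite Xp pq. Qed.

Lemma diagonal_op_id : diagonal_op idfun (fun=> 1).
Proof. by split=> // m; rewrite scale1r. Qed.

Lemma diagonal_op_comp X Y p q : diagonal_op X p -> diagonal_op Y q ->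
  diagonal_op (X \o Y) (fun m => p m * q m).
Proof.
move=> [linX Xp] [linY Yq]; split=> [c u v|m] /=; first by rewrite linY linX.
(* Adding [0] gives the scaled ket the shape [c *: u + v] that [linear] speaks of. *)
rewrite Yq -[_ *: ket m]addr0 linX linear_fun0 // addr0 Xp scalerA.
by rewrite mulrC rmorphM.
Qed.

Lemma diagonal_op_shift X p c : diagonal_op X p ->
  diagonal_op (op_shift X c) (fun m => p m + c).
Proof.
move=> [linX Xp]; rewrite /op_shift; split=> [d u v|m].
  rewrite !fctE linX !scalerDr !scalerA [d * _]mulrC.
  by rewrite addrACA.
by rewrite !fctE Xp rmorphD scalerDl.
Qed.

Lemma diagonal_op_dffact lam X p k : diagonal_op X p ->
  diagonal_op (op_dffact lam X k) (fun m => dffact lam (p m) k).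
Proof.
move=> Xp; elim: k => [|k IHk] /=.
  by apply: diagonal_op_eq diagonal_op_id => m; rewrite /dffact big_ord0.
have := diagonal_op_comp IHk (diagonal_op_shift (- (lam *+ k)) Xp).
by apply: diagonal_op_eq => m; rewrite /dffact big_ord_recr.
Qed.

(** The arbitrary index sequence covers both the sum over [k < n.+1] and the one over
    [r <= k < n.+1]. *)
Lemma diagonal_op_sum (I : Type) (s : seq I) (c : I -> R) (X : I -> V -> V) p :
  (forall i, diagonal_op (X i) (p i)) ->
  diagonal_op (\sum_(i <- s) (c i)%:C *: X i)
    (fun m => \sum_(i <- s) c i * p i m).
Proof.
move=> Xp; split=> [d u v|m]; rewrite !fct_sumE.
  rewrite scaler_sumr -big_split; apply: eq_bigr => i _ /=.
  by rewrite !fctE (Xp i).1 scalerDr !scalerA mulrC.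
rewrite rmorph_sum scaler_suml; apply: eq_bigr => i _.
by rewrite !fctE (Xp i).2 scalerA rmorphM.
Qed.

End DiagonalOperators.

Section BosonOperators.
Variables (R : realType) (V : lmodType R[i]).
Variables (dot : {dot V for (@Num.conj R[i])}) (ket : nat -> V).
Variables (a adag : {linear V -> V}).
Hypothesis boson : boson_operators dot ket a adag.

(** Induction wraps the operator for [k] between an outer [adag] and an inner [a]. On [ket m.+1]
    these contribute [Num.sqrt m.+1%:R] twice, and [(m + 1) (m)_k = (m + 1)_(k + 1)]. On [ket 0] the
    inner [a] gives [0], matching the leading factor [0] of [(0)_(k + 1)]. *)
Lemma diagonal_op_normal_ordered k :
  diagonal_op ket (iter k adag \o iter k a) (fun m => ffactr m%:R k).
Proof.
elim: k => [|k [linW Wk]].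
  by apply: diagonal_op_eq (diagonal_op_id _) => m; rewrite /ffactr big_ord0.
have WS v : (iter k.+1 adag \o iter k.+1 a) v
    = adag ((iter k adag \o iter k a) (a v)) by rewrite /= -iterSr.
split=> [c u v|[|m]]; rewrite !WS.
- by rewrite linearP linW linearP.
- rewrite (annih_ket0 boson) (linear_fun0 linW) linear0.
  by rewrite ffactrS mul0r scale0r.
- rewrite (annih_ketS boson) -[_ *: ket m]addr0 linW (linear_fun0 linW).
  rewrite addr0 Wk.
  rewrite !linearZ /= (creat_ket boson) !scalerA -!rmorphM; congr (_%:C *: _).
  by rewrite mulrAC -expr2 sqr_sqrtr ?ler0n // ffactrS -natr1 addrK.
Qed.

Lemma diagonal_op_number : diagonal_op ket (adag \o a) (fun m => m%:R).
Proof.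
apply: diagonal_op_eq (diagonal_op_normal_ordered 1) => m.
by rewrite /ffactr big_ord1 subr0.
Qed.

End BosonOperators.

Theorem theorem1 (R : realType) (lam : R) (r : nat)
    (V : lmodType R[i]) (dot : {dot V for (@Num.conj R[i])}) (ket : nat -> V)
    (a adag : {linear V -> V}) :
  lam != 0 ->
  boson_operators dot ket a adag ->
  (forall n : nat,
     op_dffact lam (op_shift (number_op a adag) r%:R) n
       = op_dffact lam (op_shift (adag \o a) r%:R) n
     /\ op_dffact lam (op_shift (adag \o a) r%:R) n
       = \sum_(k < n.+1)
           (rstirling2 lam r (n + r) (k + r))%:C *: (iter k adag \o iter k a))
  /\
  (forall n : nat, (r <= n)%N ->
     op_dffact lam (number_op a adag) (n - r) \o (iter r adag \o iter r a)
       = op_dffact lam (adag \o a) (n - r) \o (iter r adag \o iter r a)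
     /\ op_dffact lam (adag \o a) (n - r) \o (iter r adag \o iter r a)
       = \sum_(r <= k < n.+1)
           (rstirling2 lam r n k)%:C *: (iter k adag \o iter k a)).
Proof.
move=> _ boson; have span := ket_span boson.
have Dn := diagonal_op_number boson.
have Dk := diagonal_op_normal_ordered boson.
split=> n => [|rn]; split=> //.
  have D := diagonal_op_dffact lam n (diagonal_op_shift r%:R Dn).
  apply: (diagonal_op_ext span D).
    by apply: diagonal_op_sum => k; apply: Dk.
  by move=> m; apply: dffact_rstirling2.
have D := diagonal_op_comp (diagonal_op_dffact lam (n - r) Dn) (Dk r).
apply: (diagonal_op_ext span D).
  by apply: diagonal_op_sum => k; apply: Dk.
(* Only the [m] inside [dffact] becomes [(m - r) + r], with subtraction in [R]; the factor [(m)_r]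
   keeps its [m]. *)
move=> m /=; rewrite -{1}[m%:R](subrK r%:R) dffact_rstirling2 subnK //.
(* Shifting the index by [r] makes both sums run over [k < (n - r).+1], to be compared term by
   term. *)
rewrite (big_addn 0%N _ r) subSn // big_mkord mulr_suml.
by apply: eq_bigr => k _; rewrite ffactrD -mulrA [ffactr _ r * _]mulrC.
Qed.
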